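(* Let $G$ be a finite abelian group. Assume that $G$ and all its subgroups have the PT property. If $\Omega\subset G$ tiles $G$ by translation, then $\Omega$ is a spectral set.
   Context: For a finite abelian group $G$ (written additively), a pair $(\Omega,T)$ of subsets of $G$ is a tiling pair if every $g\in G$ can be written uniquely as $g=\omega+t$ with $\omega\in\Omega$, $t\in T$; $\Omega$ tiles $G$ by translation if $(\Omega,T)$ is a tiling pair for some $T\subset G$. A nonempty subset $A\subset G$ is periodic if there is a nonzero $g\in G$ with $A+g=A$. $G$ has the periodic tiling property (PT property) if for every tiling pair $(\Omega,T)$ of $G$, either $\Omega$ is periodic, or there is a periodic set $T'\subset G$ such that $(\Omega,T')$ is also a tiling pair. Convention: the trivial group is regarded as having the PT property. A nonempty set $\Omega\subset G$ is spectral if there is a set $\Lambda\subset\widehat{G}$ of characters whose restrictions to $\Omega$ form an orthogonal basis of $L^2(\Omega)$; equivalently $|\Lambda|=|\Omega|$ and $\sum_{x\in\Omega}\chi(x)\overline{\chi'(x)}=0$ for all distinct $\chi,\chi'\in\Lambda$. *)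

(* Defs.v *)
From mathcomp Require Import all_boot all_order all_algebra all_fingroup.
From mathcomp Require Import all_solvable all_field all_character.

Set Implicit Arguments.
Unset Strict Implicit.
Unset Printing Implicit Defensive.

Import GroupScope GRing.Theory.

(* Groups are written multiplicatively, as MathComp finite groups are; the
   ambient group is an abelian G : {group gT}, so that its subgroups are just
   the H : {group gT} with H \subset G. *)

Definition tiling_pair (gT : finGroupType) (G A B : {set gT}) : Prop :=
  [/\ A \subset G, B \subset G &
      forall g, g \in G ->
        exists! p : gT * gT, [/\ p.1 \in A, p.2 \in B & g = p.1 * p.2]].

Definition tiles (gT : finGroupType) (G A : {set gT}) : Prop :=
  exists B : {set gT}, tiling_pair G A B.

Definition periodic (gT : finGroupType) (G A : {set gT}) : Prop :=
  [/\ A != set0, A \subset G &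
      exists g : gT, [/\ g \in G, g != 1 & A :* g = A]].

(* The trivial group has no periodic subset, hence would fail the second
   alternative; it has the PT property by convention. *)
Definition PT_property (gT : finGroupType) (G : {group gT}) : Prop :=
  G :=: 1 \/
  forall A B : {set gT}, tiling_pair G A B ->
    periodic G A \/
    exists B' : {set gT}, periodic G B' /\ tiling_pair G A B'.

Section Spectral.

Variables (gT : finGroupType) (G : {group gT}).

(* L^2(A) for the counting measure. The scalars are the algebraic complex
   numbers: they contain all values of characters of finite groups. *)
Definition L2 (A : {set gT}) := {ffun {x : gT | x \in A} -> algC^o}.

Definition L2_restr (A : {set gT}) (chi : 'CF(G)) : L2 A :=
  [ffun x => chi (val x)].

Definition L2_dot (A : {set gT}) (f h : L2 A) : algC :=
  (\sum_x f x * (h x)^*)%R.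

(* L lists a set of characters; it has no repetition because the restrictions
   of its members form a basis. *)
Definition spectral (A : {set gT}) : Prop :=
  [/\ A != set0, A \subset G &
      exists L : seq 'CF(G),
        [/\ {subset L <= [pred chi | chi \is a linear_char]},
            {in L &, forall chi chi', chi != chi' ->
               L2_dot (L2_restr A chi) (L2_restr A chi') = 0%R}
          & basis_of fullv [seq L2_restr A chi | chi <- L]]].

End Spectral.

(* Main.v *)
Require Import Defs.
From mathcomp Require Import all_boot all_order all_algebra all_fingroup.
From mathcomp Require Import all_solvable all_field all_character.

(* Induction on |G|. For a tile A of G, the PT property yields a subgroup H of
   prime order which is a period of A or of a complement of A; in both cases
   A / H tiles G / H. Since G is abelian, G / H embeds in G, so it inherits the
   hypotheses and A / H has a spectrum, which is inflated to characters of G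
   trivial on H. If a complement of A is H-periodic, then A maps bijectively onto
   A / H and the inflated spectrum is a spectrum of A. If A is H-periodic, it is
   multiplied by the powers psi^k, k < |H|, of a character psi of G nontrivial
   on H. *)

(** * Quotients of an abelian group by subgroups of prime order *)

Section QuotientEmbedding.

Set Implicit Arguments.
Unset Strict Implicit.

Import GroupScope.

(** Induction on the order of [G], with [x] in [G] of maximal order. If [<[x]>] meets [H] trivially,
    its image is a direct factor of [G / H] with a complement [M / H], and induction embeds [M / H]
    in [M]. Otherwise [H] lies in [<[x]>], which is a direct factor of [G], and only a cyclic group
    has to be treated. *)
Lemma isog_quotient_prime (gT : finGroupType) (G H : {group gT}) :
    abelian G -> H \subset G -> prime #|H| ->
  exists2 K : {group gT}, K \subset G & G / H \isog K.
Proof.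
move=> + + prH; have [n] := ubnP #|G|.
elim: n G => // n IHn G /ltnSE-leGn abG sHG.
have nHG : G \subset 'N(H) by rewrite cents_norm // (sub_abelian_cent2 abG).
have [x Gx ox] := exponent_witness (abelian_nil abG).
have sxG : <[x]> \subset G by rewrite cycle_subG.
have Nx : x \in 'N(H) := subsetP nHG x Gx.
have ntx : 1 < #[x].
  rewrite order_gt1; apply: contraTneq prH => x1.
  have /exponentP eG : exponent G %| 1 by rewrite ox x1 order1.
  suff -> : H :=: 1 by rewrite cards1.
  by apply/trivgP/subsetP=> y /(subsetP sHG)/eG; rewrite expg1 inE => ->.
have [tixH | ntxH] := eqVneq (<[x]> :&: H) 1.
  have isox : <[x]> \isog <[x]> / H.
    by rewrite quotient_isog ?(subset_trans sxG) // setIC.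
  have oxq : #[coset H x] = #[x].
    by rewrite !orderE (card_isog isox) /= quotient_cycle.
  have Gxq : coset H x \in G / H by rewrite mem_quotient.
  (* The exponent of [G / H] divides that of [G], which is the order of [x]; so the image of [x]
     again has maximal order and generates a direct factor. *)
  have exq : #[coset H x] = exponent (G / H).
    apply/eqP; rewrite eqn_dvd dvdn_exponent //=.
    by rewrite oxq -ox exponent_quotient.
  have abGq := quotient_abelian H abG.
  (* Splitting the image of <[x]> off G / H, and not <[x]> off G, yields a
     complement of <[x]> in G that contains H. *)
  case/splitsP: (abelian_splits Gxq exq abGq) => Mq.
  case/complP=> tixM defGq.
  have sMqG : Mq \subset G / H by rewrite -defGq mulG_subr.
  have nsHG : H <| G by rewrite -sub_abelian_normal.
  have [M defMq sHM sMG] := inv_quotientS nsHG sMqG.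
  have ltMG : #|M| < #|G|.
    rewrite proper_card // properEneq sMG andbT.
    apply: contraTneq ntx => /= defM; rewrite -oxq order_gt1 negbK.
    rewrite -in_set1 -[[set 1]]/(1 : {set _}) -tixM inE cycle_id /= defMq.
    by rewrite mem_quotient // defM.
  have [K sKM isoK] := IHn M (leq_trans ltMG leGn) (abelianS sMG abG) sHM.
  have tixK : <[x]> :&: K = 1.
    (* The image of [<[x]> :&: M] in [G / H] is trivial, so this intersection lies in [<[x]> :&:
       H]. *)
    suff tixM' : <[x]> :&: M = 1.
      by apply/trivgP; rewrite -tixM' setIS.
    apply/trivgP; rewrite -tixH subsetI subsetIl /=.
    rewrite -quotient_sub1 ?(subset_trans (subsetIl _ _)) //;
      last exact: subset_trans nHG.
    apply: subset_trans (quotientI _ _ _) _.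
    by rewrite /= quotient_cycle // -defMq tixM.
  exists (<[x]> <*> K)%G; first by rewrite join_subG sxG (subset_trans sKM).
  apply: (isog_dprod (A := <[coset H x]>) (B := Mq)).
  - rewrite dprodE ?defGq //.
    by rewrite (sub_abelian_cent2 abGq) ?cycle_subG.
  - apply: dprodEY tixK.
    by rewrite (sub_abelian_cent2 abG) // (subset_trans sKM).
  - by rewrite -quotient_cycle // isog_sym; apply: isox.
  - by rewrite defMq.
have sHx : H \subset <[x]>.
  by apply: contraR ntxH => nsHx; rewrite setIC prime_TIg.
case/splitsP: (abelian_splits Gx (esym ox) abG) => L /complP[tixL defG].
have sLG : L \subset G by rewrite -defG mulG_subr.
have nHL := subset_trans sLG nHG; have nHx := subset_trans sxG nHG.
have pdivx : #|H| %| #[x] by rewrite orderE cardSg.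
have sxpx : <[x ^+ #|H|]> \subset <[x]> by rewrite cycle_subG mem_cycle.
(* The quotient [<[x]> / H] is cyclic of order [#[x] %/ #|H|], which is also the order of
   [x ^+ #|H|]. *)
exists (<[x ^+ #|H|]> <*> L)%G.
  by rewrite join_subG sLG (subset_trans sxpx).
apply: (isog_dprod (A := <[x]> / H) (B := L / H)).
- rewrite dprodE -?quotientMl ?defG ?quotient_cents //.
    by rewrite (sub_abelian_cent2 abG).
  by rewrite -quotientGI // tixL quotient1.
- apply: dprodEY; first by rewrite (sub_abelian_cent2 abG) ?(subset_trans sxpx).
  by apply/trivgP; rewrite -tixL setSI.
- rewrite isog_cyclic_card ?quotient_cyclic ?cycle_cyclic //=.
  by rewrite -orderE orderXdiv // card_quotient // -divgS.
- rewrite isog_sym quotient_isog //.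
  by apply/trivgP; rewrite -tixL setSI.
Qed.

End QuotientEmbedding.

(** * Tilings, their transport along isomorphisms, and their quotients by periods *)

Section Tilings.

Set Implicit Arguments.
Unset Strict Implicit.

Import GroupScope.

(** Uniqueness of the factorisation is injectivity of the product map on [setX A B], which for a map
    onto [G] amounts to equality of cardinals. Images and quotients are easier to handle in this
    form. *)
Lemma tiling_pairE (gT : finGroupType) (G : {group gT}) (A B : {set gT}) :
  tiling_pair G A B <->
  [/\ A \subset G, B \subset G, A * B = G & (#|A| * #|B|)%N = #|G|].
Proof.
pose f : gT * gT -> gT := uncurry *%g.
have defAB : A * B = f @: setX A B := curry_imset2X _ A B.
split=> [[sAG sBG tAB] | [sAG sBG defG cardG]].
  have defG : A * B = G.
    apply/eqP; rewrite eqEsubset mul_subG //=; apply/subsetP=> g Gg.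
    by have [[a b] [[/= Aa Bb ->] _]] := tAB g Gg; apply: mem_mulg.
  split=> //; rewrite -defG defAB card_in_imset ?cardsX //.
  move=> [a b] [c d] /setXP[Aa Bb] /setXP[Ac Bd] /= eq_ab.
  have Gab : a * b \in G by rewrite groupM ?(subsetP sAG a) ?(subsetP sBG b).
  have [r [_ r_uniq]] := tAB _ Gab.
  have <- : r = (a, b) by apply: r_uniq.
  exact: r_uniq.
split=> // g; rewrite -{1}defG => /mulsgP[a b Aa Bb ->].
exists (a, b); split=> // -[c d] [/= Ac Bd eq_ab].
have /imset_injP f_inj : #|f @: setX A B| == #|setX A B|.
  by rewrite -defAB defG cardsX cardG.
by apply: f_inj; rewrite ?inE ?Aa ?Bb ?Ac ?Bd.
Qed.

Lemma tiling_pairC (gT : finGroupType) (G : {group gT}) (A B : {set gT}) :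
  abelian G -> tiling_pair G A B -> tiling_pair G B A.
Proof.
move=> abG /tiling_pairE[sAG sBG defG cardG]; apply/tiling_pairE.
split; rewrite // 1?mulnC // -defG.
by apply: centC; rewrite (sub_abelian_cent2 abG).
Qed.

Lemma tiling_pair_neq0 (gT : finGroupType) (G : {group gT}) (A B : {set gT}) :
  tiling_pair G A B -> A != set0.
Proof.
move=> /tiling_pairE[_ _ defG _].
have /mulsgP[a b Aa _ _] : 1 \in A * B by rewrite defG.
by apply/set0Pn; exists a.
Qed.

Lemma injm_tiling_pair (aT rT : finGroupType) (G K : {group aT})
    (f : {morphism G >-> rT}) (A B : {set aT}) :
    'injm f -> K \subset G -> tiling_pair K A B ->
  tiling_pair (f @* K) (f @* A) (f @* B).
Proof.
move=> injf sKG /tiling_pairE[sAK sBK defK cardK].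
have [sAG sBG] := (subset_trans sAK sKG, subset_trans sBK sKG).
apply/tiling_pairE; split; rewrite ?morphimS //.
  by rewrite -morphimMl // defK.
by rewrite !card_injm.
Qed.

Lemma injm_periodic (aT rT : finGroupType) (G K : {group aT})
    (f : {morphism G >-> rT}) (A : {set aT}) :
    'injm f -> K \subset G -> periodic K A ->
  periodic (f @* K) (f @* A).
Proof.
move=> injf sKG [/set0Pn[a Aa] sAK [g [Kg nt_g Ag]]].
have [sAG Gg] := (subset_trans sAK sKG, subsetP sKG g Kg).
split; [|exact: morphimS|].
  by apply/set0Pn; exists (f a); rewrite mem_morphim // (subsetP sAG).
exists (f g); split; first exact: mem_morphim.
  by rewrite morph_injm_eq1.
by rewrite -morphim_set1 // -morphimMl // Ag.
Qed.

Lemma PT_property_isog (aT rT : finGroupType) (G : {group aT})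
    (K : {group rT}) :
  G \isog K -> PT_property K -> PT_property G.
Proof.
case/isogP=> f injf defK.
have {K defK} -> : K = (f @* G)%G by apply/val_inj/esym.
case=> [fG1 | PTK].
  left; apply/eqP; rewrite trivg_card1 -(card_injm injf) //.
  by rewrite fG1 cards1.
right=> A B tAB; have /tiling_pairE[sAG sBG _ _] := tAB.
pose f' := invm_morphism injf; have injf' : 'injm f' := injm_invm injf.
have f'K (C : {set aT}) : C \subset G -> f' @* (f @* C) = C.
  exact: morphim_invm.
have := PTK _ _ (injm_tiling_pair injf (subxx G) tAB).
case=> [pA | [B' [pB' tAB']]]; [left | right; exists (f' @* B')].
  rewrite -(f'K A) // -[X in periodic X](f'K G) //.
  exact: injm_periodic.
have := injm_tiling_pair injf' (subxx _) tAB'.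
have := injm_periodic injf' (subxx _) pB'.
by rewrite !f'K.
Qed.

(* Every subgroup of G / H is isomorphic to one of G, because G / H is. *)
Lemma PT_property_quotient (gT : finGroupType) (G H : {group gT}) :
    abelian G -> H \subset G -> prime #|H| ->
    (forall K : {group gT}, K \subset G -> PT_property K) ->
  forall K : {group coset_of H}, K \subset G / H -> PT_property K.
Proof.
move=> abG sHG prH PTG K sKG.
have [L sLG] := isog_quotient_prime abG sHG prH.
case/isogP=> f injf defL.
apply: (PT_property_isog (K := f @* K)).
  exact: sub_isog.
by apply: PTG; rewrite (subset_trans _ sLG) // -defL morphimS.
Qed.

(** The powers of a period fix [A] too, and by Cauchy's theorem one of them has prime order. *)
Lemma periodic_prime (gT : finGroupType) (G : {group gT}) (A : {set gT}) :
  periodic G A ->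
  exists H : {group gT}, [/\ H \subset G, prime #|H| & A * H = A].
Proof.
case=> _ _ [g [Gg nt_g Ag]].
have Agn n : A :* (g ^+ n) = A.
  by elim: n => [|n IHn]; rewrite ?mulg1 // expgSr rcosetM IHn.
have pr_p := pdiv_prime (_ : 1 < #[g]); rewrite order_gt1 in pr_p.
have /(Cauchy (pr_p nt_g))[h gh oh] : pdiv #[g] %| #|<[g]>|.
  by rewrite -orderE pdiv_dvd.
exists <[h]>%G; split; rewrite ?cycle_subG -?orderE ?oh ?pr_p //.
  by apply: subsetP gh; rewrite cycle_subG.
apply/eqP; rewrite eqEsubset mulG_subl andbT.
apply/subsetP=> _ /mulsgP[a x Aa hx ->].
have /cycleP[n ->] : x \in <[g]> by apply: subsetP hx; rewrite cycle_subG.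
by rewrite -(Agn n) mem_rcoset mulgK.
Qed.

(** Since [B * H = B], the fibres of the projection of [B] to [B / H] are full cosets of [H]. *)
Lemma big_quotient (R : Type) (idx : R) (op : Monoid.com_law idx)
    (gT : finGroupType) (H : {group gT}) (B : {set gT}) (F : gT -> R) :
    B \subset 'N(H) -> B * H = B ->
  \big[op/idx]_(x in B) F x =
    \big[op/idx]_(y in B / H) \big[op/idx]_(x in (y : {set gT})) F x.
Proof.
move=> nHB BH; rewrite (partition_big (coset H) [in B / H]); last first.
  by move=> x Bx; apply: mem_morphim => //; apply: (subsetP nHB).
apply: eq_bigr => _ /morphimP[b Nb Bb ->]; apply: eq_bigl => x.
apply/andP/idP => [[Bx /eqP <-] | x_bH].
  by rewrite val_coset ?rcoset_refl // (subsetP nHB).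
rewrite (coset_mem x_bH); split=> //.
move: x_bH; rewrite val_coset // norm_rlcoset // => /lcosetP[h Hh ->].
by rewrite -BH mem_mulg.
Qed.

Lemma card_quotient_mulG (gT : finGroupType) (H : {group gT}) (B : {set gT}) :
  B \subset 'N(H) -> B * H = B -> (#|B / H| * #|H|)%N = #|B|.
Proof.
move=> nHB BH; rewrite -[RHS]sum1_card (big_quotient _ _ nHB BH) -sum_nat_const.
apply: eq_bigr => _ /morphimP[b Nb _ ->].
by rewrite sum1_card val_coset // card_rcoset.
Qed.

(** A count: the product of [A / H] and [B / H] covers [G / H], and [B] is a union of [#|B / H|]
    cosets, so [#|A| * #|B| = #|G| <= #|A / H| * #|B|]. Hence [A] loses no point in the quotient,
    and the covering is a tiling. *)
Lemma tiling_pair_quotient (gT : finGroupType) (G H : {group gT})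
    (A B : {set gT}) :
    abelian G -> H <| G -> B * H = B -> tiling_pair G A B ->
  tiling_pair (G / H) (A / H) (B / H) /\ #|A / H| = #|A|.
Proof.
move=> abG /andP[sHG nHG] BH tAB.
have B_neq0 := tiling_pair_neq0 (tiling_pairC abG tAB).
case/tiling_pairE: tAB => sAG sBG defG cardG.
have [nHA nHB] := (subset_trans sAG nHG, subset_trans sBG nHG).
have defGq : A / H * (B / H) = G / H by rewrite -quotientMl ?defG.
have cardB := card_quotient_mulG nHB BH.
have cardGq : (#|G / H| * #|H|)%N = #|G|.
  by rewrite card_quotient // mulnC Lagrange.
have leGq : #|G / H| <= #|A / H| * #|B / H|.
  have defAB : A / H * (B / H) = uncurry *%g @: setX (A / H) (B / H).
    exact: curry_imset2X.
  by rewrite -defGq defAB -cardsX leq_imset_card.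
have leA : #|A / H| <= #|A|.
  by rewrite quotientE morphimEsub ?leq_imset_card.
have B_gt0 : 0 < #|B| by rewrite card_gt0.
have cardA : #|A / H| = #|A|.
  apply/eqP; rewrite eqn_leq leA -(leq_pmul2r B_gt0) cardG -cardGq -cardB mulnA.
  by rewrite leq_mul2r leGq orbT.
split=> //; apply/tiling_pairE; split; rewrite ?quotientS //.
apply/eqP; rewrite -(eqn_pmul2r (cardG_gt0 H)) -mulnA cardB cardA cardG.
by rewrite cardGq.
Qed.

End Tilings.

(** * Spectra: orthogonal families of characters and their inflation from a quotient *)

Section Spectra.

Set Implicit Arguments.
Unset Strict Implicit.

Import GRing.Theory Num.Theory.
Local Open Scope ring_scope.

(* A spectrum, presented as an indexed family so that no repetition-free list
   of characters has to be exhibited. *)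
Definition has_spectrum (gT : finGroupType) (G : {group gT}) (A : {set gT}) :=
  exists (I : finType) (f : I -> 'CF(G)),
    [/\ #|I| = #|A|, forall i, f i \is a linear_char &
        forall i j, i != j -> \sum_(x in A) f i x * (f j x)^* = 0].

(** Each restricted character has squared norm [#|A|], which is nonzero, so orthogonality gives
    freeness; the family has as many members as the dimension of [L2 A]. *)
Lemma has_spectrum_spectral (gT : finGroupType) (G : {group gT})
    (A : {set gT}) :
  A != set0 -> A \subset G -> has_spectrum G A -> spectral G A.
Proof.
move=> A_neq0 sAG [I [f [cardI linf orthf]]]; split=> //.
have dotE i j : L2_dot (L2_restr A (f i)) (L2_restr A (f j)) =
    \sum_(x in A) f i x * (f j x)^*.
  by rewrite big_sub; apply: eq_bigr => x _; rewrite !ffunE.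
have dot_diag i : \sum_(x in A) f i x * (f i x)^* = #|A|%:R.
  rewrite -sum1_card natr_sum; apply: eq_bigr => x Ax.
  by rewrite -normCK normC_lin_char ?expr1n // (subsetP sAG).
have cardA_neq0 : #|A|%:R != 0 :> algC by rewrite pnatr_eq0 cards_eq0.
exists (map f (enum I)); split.
- by move=> _ /mapP[i _ ->]; apply: linf.
- move=> _ _ /mapP[i _ ->] /mapP[j _ ->] neq_ij.
  by rewrite dotE orthf //; apply: contraNneq neq_ij => ->.
pose X := map_tuple (fun i => L2_restr A (f i)) (enum_tuple I).
have defX : [seq L2_restr A chi | chi <- [seq f i | i <- enum I]] = X.
  by rewrite -map_comp.
have nthX (i : 'I_#|I|) : X`_i = L2_restr A (f (enum_val i)).
  by rewrite (enum_val_nth (enum_val i)) (nth_map (enum_val i)) // size_tuple.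
have dimL2 : \dim {: L2 A} = #|A|.
  (* By conversion, the dimension of a function space is the size of the domain times the dimension
     of the scalars, here 1. *)
  rewrite dimvf; transitivity (#|{: {x | x \in A}}| * 1)%N; first by [].
  by rewrite muln1 card_sig.
rewrite defX basisEfree subvf dimL2 size_tuple /= -cardI leqnn andbT.
apply/freeP=> k sum0 i.
have := congr1 (fun g => L2_dot g X`_i) sum0.
have -> : L2_dot 0 X`_i = 0.
  by apply: big1 => x _; rewrite ffunE mul0r.
have -> : L2_dot (\sum_(j < #|I|) k j *: X`_j) X`_i =
    \sum_(j < #|I|) k j * L2_dot X`_j X`_i.
  under [RHS]eq_bigr do rewrite mulr_sumr.
  rewrite exchange_big; apply: eq_bigr => x _ /=.
  rewrite sum_ffunE mulr_suml; apply: eq_bigr => j _.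
  by rewrite ffunE mulrA.
rewrite (bigD1 i) //= big1 => [|j neq_ji].
  rewrite addr0 nthX dotE dot_diag => /eqP.
  by rewrite mulf_eq0 (negPf cardA_neq0) orbF => /eqP.
rewrite !nthX dotE orthf ?mulr0 //.
by rewrite (inj_eq enum_val_inj).
Qed.

Lemma has_spectrum_quotient_inj (gT : finGroupType) (G H : {group gT})
    (A : {set gT}) :
    (H <| G)%g -> A \subset G -> #|(A / H)%g| = #|A| ->
  has_spectrum (G / H) (A / H)%g -> has_spectrum G A.
Proof.
move=> nsHG sAG cardA [I [f [cardI linf orthf]]].
have nHA : A \subset 'N(H)%g := subset_trans sAG (normal_norm nsHG).
have /imset_injP coset_inj : #|coset H @: A| == #|A|.
  by rewrite -cardA quotientE morphimEsub.
exists I, (fun i => f i %% H)%CF; split=> [|i|i j neq_ij].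
- by rewrite cardI.
- exact: cfMod_lin_char.
rewrite -[RHS](orthf i j neq_ij) [in RHS]quotientE morphimEsub // big_imset //=.
by apply: eq_bigr => x Ax; rewrite !cfModE // (subsetP sAG).
Qed.

(** The kernels of the linear characters intersect in the derived subgroup, which is trivial for
    abelian [G]. *)
Lemma lin_char_separates (gT : finGroupType) (G : {group gT}) (h : gT) :
    abelian G -> h \in G -> h != 1%g ->
  exists2 psi : 'CF(G), psi \is a linear_char & psi h != 1.
Proof.
move=> abG Gh nt_h.
pose P i := ('chi[G]_i \is a linear_char) && ('chi_i h != 1).
have [/existsP[i /andP[lin_i chi_h]] | no_chi] := boolP [exists i, P i].
  by exists 'chi_i.
case/negP: nt_h; rewrite -in_set1 -[[set _]](derG1P abG) -cap_cfker_lin_irr.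
apply/bigcapP=> i lin_i; rewrite cfkerEirr inE lin_char1 //.
by apply: contraNT no_chi => chi_h; apply/existsP; exists i; rewrite /P lin_i.
Qed.

Lemma has_spectrum_quotient_periodic (gT : finGroupType) (G H : {group gT})
    (A : {set gT}) :
    abelian G -> H \subset G -> prime #|H| -> A \subset G -> (A * H = A)%g ->
  has_spectrum (G / H) (A / H)%g -> has_spectrum G A.
Proof.
move=> abG sHG prH sAG AH [I [f [cardI linf orthf]]].
have nsHG : (H <| G)%g by rewrite -sub_abelian_normal.
have nHA : A \subset 'N(H)%g := subset_trans sAG (normal_norm nsHG).
have [h Hh nt_h] : exists2 h, h \in H & h != 1%g.
  by apply/trivgPn; rewrite trivg_card1; apply: contraTneq prH => ->.
have Gh := subsetP sHG h Hh.
have [psi linpsi psi_h] := lin_char_separates abG Gh nt_h.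
(* The order of [psi h] divides the prime [#|H|] and is not 1. *)
have z_prim : #|H|.-primitive_root (psi h).
  have [m prim_m] : {m | m.-primitive_root (psi h) & (m %| #|H|)%N}.
    apply: prim_order_exists; rewrite ?cardG_gt0 // -lin_charX //.
    by rewrite expg_cardG // lin_char1.
  case/primeP: prH => _ prH /prH/orP[] /eqP def_m; last by rewrite -def_m.
  by rewrite -[psi h]expr1 -def_m (prim_expr_order prim_m) eqxx in psi_h.
have linX k : psi ^+ k \is a linear_char by rewrite rpredX.
exists (I * 'I_#|H|)%type.
exists (fun u : I * 'I_#|H| => (f u.1 %% H)%CF * psi ^+ u.2).
split=> [|[i k]|[i k] [j l]] /=.
- by rewrite card_prod card_ord cardI card_quotient_mulG.
- by rewrite rpredM ?cfMod_lin_char.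
have sumE (x : gT) : x \in G ->
    ((f i %% H)%CF * psi ^+ k) x * (((f j %% H)%CF * psi ^+ l) x)^* =
    f i (coset H x) * (f j (coset H x))^* * (psi x ^+ k * (psi x ^+ l)^*).
  by move=> Gx; rewrite !cfunE !exp_cfunE // !cfModE // rmorphM mulrACA.
rewrite (eq_bigr _ (fun x Ax => sumE x (subsetP sAG x Ax))) => neq_ij.
(* For equal exponents the factors [psi] cancel, having modulus 1, and the sum is [#|H|] times the
   one over [A / H]. *)
have [eq_kl | neq_kl] := eqVneq k l.
  have neqij : i != j by apply: contraNneq neq_ij => ->; rewrite eq_kl.
  rewrite (big_quotient _ _ nHA AH).
  transitivity (\sum_(y in (A / H)%g) #|H|%:R * (f i y * (f j y)^*)).
    apply: eq_bigr => _ /morphimP[a Na Aa ->].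
    have Ga := subsetP sAG a Aa.
    transitivity (\sum_(x in (H :* a)%g)
        (f i (coset H a) * (f j (coset H a))^*)); last first.
      by rewrite sumr_const card_rcoset mulr_natl.
    rewrite val_coset //.
    apply: eq_bigr => x Hax.
    have Gx : x \in G.
      by case/rcosetP: Hax => y Hy ->; rewrite groupM ?(subsetP sHG y).
    rewrite -eq_kl -lin_charX // -normCK normC_lin_char ?groupX //.
    by rewrite expr1n mulr1 (coset_mem _ : coset H x = coset H a) ?val_coset.
  by rewrite -mulr_sumr orthf ?mulr0.
(* For distinct exponents, translation by [h] preserves [A] and the inflated characters but
   multiplies the sum by [c], which differs from 1; so the sum is zero. *)
pose c := psi h ^+ k * (psi h ^+ l)^*.
set S := \sum_(x in A) _.
have c_neq1 : c != 1.
  rewrite /c -!lin_charX // -lin_charV_conj ?groupX // lin_charV ?groupX //.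
  apply: contraNneq neq_kl => /divr1_eq/eqP.
  by rewrite !lin_charX // (eq_prim_root_expr z_prim) !modn_small ?ltn_ord.
have mulAh (x : gT) : (x * h \in A)%g = (x \in A).
  apply/idP/idP=> Ax; last by rewrite -AH mem_mulg.
  by rewrite -(mulgK h x) -AH mem_mulg ?groupV.
have eqS : S = c * S.
  rewrite mulr_sumr [LHS](reindex_inj (mulIg h)) /=.
  apply: eq_big => [x | x]; rewrite mulAh // => Ax.
  have Gx := subsetP sAG x Ax; have Nx := subsetP nHA x Ax.
  have Nh := subsetP (normG H) h Hh.
  have eq_coset : coset H (x * h)%g = coset H x.
    by rewrite morphM //= (coset_id Hh) mulg1.
  rewrite eq_coset lin_charM // !exprMn rmorphM.
  by rewrite [X in _ * X = _]mulrACA [RHS]mulrC /c !mulrA.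
have : (1 - c) * S == 0 by rewrite mulrBl mul1r -eqS subrr.
by rewrite mulf_eq0 subr_eq0 eq_sym (negPf c_neq1) => /eqP.
Qed.

End Spectra.

(** * The induction on the order of the group *)

Lemma tiles_has_spectrum (gT : finGroupType) (G : {group gT})
    (A B : {set gT}) :
    abelian G -> (forall H : {group gT}, H \subset G -> PT_property H) ->
  tiling_pair G A B -> has_spectrum G A.
Proof.
(* The type [gT] is generalised too, since the quotient [G / H] lives in another type. *)
have [n] := ubnP #|G|; elim: n gT G A B => // n IHn.
move=> gT G A B /ltnSE-leGn abG ptG.
have IHq (H : {group gT}) (C D : {set gT}) : H \subset G -> prime #|H| ->
    tiling_pair (G / H)%g (C / H)%g (D / H)%g ->
  has_spectrum (G / H) (C / H)%g.
  move=> sHG prH; apply: IHn; last exact: PT_property_quotient.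
    by rewrite (leq_trans _ leGn) // ltn_quotient // -cardG_gt1 prime_gt1.
  exact: quotient_abelian.
have [G1 tAB | PTG tAB] := ptG G (subxx G).
  have /tiling_pairE[sAG _ _ cardAB] := tAB.
  (* In the trivial group [A] is a single point, and the trivial character is its spectrum. *)
  exists unit, (fun=> 1%R); split=> [|i|[] []] //; last exact: cfun1_lin_char.
  rewrite card_unit; apply/esym/eqP; rewrite eqn_leq card_gt0.
  rewrite (tiling_pair_neq0 tAB) (leq_trans (subset_leq_card sAG)) //.
  by rewrite G1 cards1.
case: (PTG A B tAB) => [/periodic_prime[H [sHG prH AH]] | [D [pD tAD]]].
  have nsHG : (H <| G)%g by rewrite -sub_abelian_normal.
  (* The periodic factor here is [A], so the two factors are exchanged before passing to the
     quotient and again after it. *)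
  have [tBAq _] := tiling_pair_quotient abG nsHG AH (tiling_pairC abG tAB).
  have /tiling_pairE[sAG _ _ _] := tAB.
  apply: (has_spectrum_quotient_periodic abG sHG prH sAG AH).
  apply: (IHq H A B sHG prH).
  exact: tiling_pairC (quotient_abelian H abG) tBAq.
have [H [sHG prH DH]] := periodic_prime pD.
have nsHG : (H <| G)%g by rewrite -sub_abelian_normal.
have [tADq cardA] := tiling_pair_quotient abG nsHG DH tAD.
have /tiling_pairE[sAG _ _ _] := tAD.
exact: has_spectrum_quotient_inj nsHG sAG cardA (IHq H A D sHG prH tADq).
Qed.

Theorem theorem1p10 (gT : finGroupType) (G : {group gT}) (abG : abelian G)
    (ptG : forall H : {group gT}, H \subset G -> PT_property H)
    (Omega : {set gT}) (tilesOmega : tiles G Omega) :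
  spectral G Omega.
Proof.
have [B tOB] := tilesOmega; have /tiling_pairE[sOG _ _ _] := tOB.
apply: has_spectrum_spectral (tiling_pair_neq0 tOB) sOG _.
exact: tiles_has_spectrum abG ptG tOB.
Qed.
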